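(* Let $A=(a_{ij})\in\mathbb{R}^{n\times n}$ be the weighted adjacency matrix of a simple directed weighted graph on $V=\{1,\dots,n\}$ (real weights of arbitrary sign) satisfying Assumptions (A1), (A2), (A3) listed in the context. Then the first-order sensitivity of the generalized algebraic connectivity is additive over edges: for every directed edge set $F$ on $V$, $$\partial_F\kappa=\sum_{e\in F}\partial_e\kappa ,$$ where $\partial_F\kappa=\frac{d}{d\epsilon}\kappa(\epsilon)\big|_{\epsilon=0}$ along the perturbation $A(\epsilon)=A+\epsilon\sum_{j\to i\in F}E_{ij}$, and $\partial_e\kappa:=\partial_{\{e\}}\kappa$ is the same quantity for the single-edge set $\{e\}$.
   Context: Graph: $V=\{1,\dots,n\}$, $n\ge 2$; the graph is simple (no self-loops, at most one edge for each ordered pair). $a_{ij}\in\mathbb{R}$ is the weight of the directed edge $j\to i$ ($a_{ij}=0$ if there is no such edge); weights may be positive, zero or negative, and $A$ need not be symmetric. The Laplacian is $L=D-A$ with $D=\mathrm{diag}(k_1^{\mathrm{in}},\dots,k_n^{\mathrm{in}})$, $k_i^{\mathrm{in}}=\sum_{j=1}^n a_{ij}$; hence $L\mathbf{1}=0$ with $\mathbf{1}=(1,\dots,1)^\top$. Assumptions. (A1) $0$ is a simple eigenvalue of $L$, and every other eigenvalue $\lambda$ of $L$ satisfies $\Re(\lambda)>0$. (A2) The left eigenvector $\xi$ of $L$ for the eigenvalue $0$ ($\xi^\top L=0$) can be chosen entrywise positive and is normalized by $\mathbf{1}^\top\xi=1$. Put $\Xi=\mathrm{diag}(\xi_1,\dots,\xi_n)$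 and define the real symmetric matrix $M=\Xi^{-1/2}\,\frac{\Xi L+L^\top\Xi}{2}\,\Xi^{-1/2}$. (A3) $M$ is positive semidefinite, and its second smallest eigenvalue $\kappa:=\lambda_2(M)$ satisfies $\kappa>0$ and is simple. The number $\kappa$ is called the generalized algebraic connectivity. Perturbation: a directed edge set $F$ on $V$ is a set of ordered pairs $j\to i$ of distinct vertices, not necessarily edges of the graph. $E_{ij}$ is the matrix unit with a $1$ in position $(i,j)$. For real $\epsilon$ with $|\epsilon|$ sufficiently small, $A(\epsilon)=A+\epsilon\sum_{j\to i\in F}E_{ij}$, and $L(\epsilon)$, $\xi(\epsilon)$ (left zero-eigenvector of $L(\epsilon)$ with $\mathbf{1}^\top\xi(\epsilon)=1$), $\Xi(\epsilon)=\mathrm{diag}(\xi(\epsilon))$, $M(\epsilon)$, $\kappa(\epsilon)=\lambda_2(M(\epsilon))$ (second smallest eigenvalue, counted with multiplicity) are the quantities built from $A(\epsilon)$ by the same formulas. *)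

(* Defs.v *)
From HB Require Import structures.
From mathcomp Require Import all_boot all_order all_algebra.
From mathcomp Require Import complex.
From mathcomp Require Import all_classical all_reals all_analysis.

Set Implicit Arguments.
Unset Strict Implicit.
Unset Printing Implicit Defensive.

Import Order.TTheory GRing.Theory Num.Theory.
Import numFieldNormedType.Exports.

Local Open Scope classical_set_scope.
Local Open Scope ring_scope.

(* [A i j] is the weight of the directed edge j -> i. *)
Definition laplacian (R : realType) (n : nat) (A : 'M[R]_n) : 'M[R]_n :=
  diag_mx (\row_i \sum_j A i j) - A.

(* The left eigenvector is kept as the row vector xi^T. *)
Definition is_left_zero_vec (R : realType) (n : nat) (L : 'M[R]_n)
    (xi : 'rV[R]_n) : Prop :=
  xi *m L = 0 /\ \sum_i xi 0 i = 1.

(* Junk value 0 when L has no normalized left zero-eigenvector. *)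
Definition left_zero_vec (R : realType) (n : nat) (L : 'M[R]_n) : 'rV[R]_n :=
  xget 0 [set xi | is_left_zero_vec L xi].

Definition has_positive_left_zero_vec (R : realType) (n : nat)
    (L : 'M[R]_n) : Prop :=
  exists2 xi : 'rV[R]_n, is_left_zero_vec L xi & forall i, 0 < xi 0 i.

Definition symmetrized_laplacian (R : realType) (n : nat) (L : 'M[R]_n)
    (xi : 'rV[R]_n) : 'M[R]_n :=
  let Xi := diag_mx xi in
  let Xi_inv_sqrt := diag_mx (\row_i (Num.sqrt (xi 0 i))^-1) in
  Xi_inv_sqrt *m (2^-1 *: (Xi *m L + L^T *m Xi)) *m Xi_inv_sqrt.

Definition gen_matrix (R : realType) (n : nat) (A : 'M[R]_n) : 'M[R]_n :=
  symmetrized_laplacian (laplacian A) (left_zero_vec (laplacian A)).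

(* All eigenvalues with multiplicity, in nondecreasing order; only meaningful
   when the characteristic polynomial splits over R, e.g. for symmetric M. *)
Definition spectrum (R : realType) (n : nat) (M : 'M[R]_n) : seq R :=
  xget [::] [set s : seq R | sorted <=%R s /\
                             char_poly M = \prod_(x <- s) ('X - x%:P)].

Definition lambda2 (R : realType) (n : nat) (M : 'M[R]_n) : R :=
  nth 0 (spectrum M) 1.

Definition gen_alg_connectivity (R : realType) (n : nat) (A : 'M[R]_n) : R :=
  lambda2 (gen_matrix A).

(* Algebraic multiplicity one. *)
Definition simple_eigenvalue (F : fieldType) (n : nat) (M : 'M[F]_n)
    (a : F) : Prop :=
  mup a (char_poly M) = 1%N.

Definition possemidef (R : realType) (n : nat) (M : 'M[R]_n) : Prop :=
  forall x : 'cV[R]_n, 0 <= (x^T *m M *m x) 0 0.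

Definition assumption_A1 (R : realType) (n : nat) (A : 'M[R]_n) : Prop :=
  simple_eigenvalue (laplacian A) 0 /\
  forall z : R[i],
    eigenvalue (map_mx (real_complex R) (laplacian A)) z -> z != 0 ->
    0 < complex.Re z.

Definition assumption_A2 (R : realType) (n : nat) (A : 'M[R]_n) : Prop :=
  has_positive_left_zero_vec (laplacian A).

Definition assumption_A3 (R : realType) (n : nat) (A : 'M[R]_n) : Prop :=
  [/\ possemidef (gen_matrix A),
      0 < gen_alg_connectivity A
    & simple_eigenvalue (gen_matrix A) (gen_alg_connectivity A)].

(* The pair (j, i) stands for j -> i. *)
Definition directed_edge_set (n : nat) (F : {set 'I_n * 'I_n}) : Prop :=
  forall e, e \in F -> e.1 != e.2.

Definition perturbed (R : realType) (n : nat) (A : 'M[R]_n)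
    (F : {set 'I_n * 'I_n}) (eps : R) : 'M[R]_n :=
  A + eps *: \sum_(e in F) delta_mx e.2 e.1.

Definition perturbed_connectivity (R : realType) (n : nat) (A : 'M[R]_n)
    (F : {set 'I_n * 'I_n}) (eps : R) : R :=
  gen_alg_connectivity (perturbed A F eps).

Definition sensitivity (R : realType) (n : nat) (A : 'M[R]_n)
    (F : {set 'I_n * 'I_n}) : R :=
  derive1 (perturbed_connectivity A F) 0.

(* xi(eps), hence M(eps) and kappa(eps), is genuinely defined at A: the
   normalized left zero-eigenvector exists, is unique and is positive. *)
Definition connectivity_defined (R : realType) (n : nat)
    (A : 'M[R]_n) : Prop :=
  has_positive_left_zero_vec (laplacian A) /\
  exists! xi : 'rV[R]_n, is_left_zero_vec (laplacian A) xi.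

(* The derivative defining [sensitivity A F] exists, as the derivative of a
   function that does not take junk values near 0. *)
Definition has_sensitivity (R : realType) (n : nat) (A : 'M[R]_n)
    (F : {set 'I_n * 'I_n}) : Prop :=
  (\forall eps \near (0 : R), connectivity_defined (perturbed A F eps)) /\
  derivable (perturbed_connectivity A F) 0 1.

(* Main.v *)
Require Import Defs.
From mathcomp Require Import all_boot all_order all_algebra.
From mathcomp Require Import spectral sesquilinear complex ring.
From mathcomp Require Import all_classical all_reals all_analysis.

(** The generalized algebraic connectivity is Frechet differentiable at [A] as a
    function of the whole weight matrix ([differentiable_gen_alg_connectivity]).
    Its derivative along an edge set is therefore the value of one linear map,
    the differential at [A], on the sum of the matrix units of the edges, and
    linearity gives additivity.

    Differentiability rests on two facts. First, the entries of [gen_matrix] are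
    differentiable functions of the weights. Indeed, with [J] the all-ones
    matrix, the normalized left zero-eigenvector of a Laplacian [L] is the
    solution [xi] of [xi *m (L + J) = const_mx 1] ([left_zero_vecP]); simplicity
    of the eigenvalue [0] makes [L + J] invertible at [A]
    ([bordered_laplacian_unit]), hence near [A], and there Cramer's rule
    applies. Positivity of [xi] persists near [A] by continuity, so the square
    roots cause no trouble and the connectivity is genuinely defined near [A].

    Second, the ordered spectrum of a symmetric matrix depends continuously on
    the matrix ([cvg_spectrum]). The characteristic polynomial of [gen_matrix B]
    evaluated at the connectivity [kappa] of [A] is the product of
    [kappa - gen_alg_connectivity B] and of a factor that is continuous at [A]
    and does not vanish there, as [kappa] is a simple eigenvalue. The polynomial
    value is differentiable in [B] and zero at [A]; dividing by the other factor
    keeps it differentiable at [A] ([differentiableM0]). *)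

Set Implicit Arguments.
Unset Strict Implicit.
Unset Printing Implicit Defensive.

Import Order.TTheory GRing.Theory Num.Theory.
Import numFieldNormedType.Exports.

Local Open Scope ring_scope.

(** * Spectrum of a real symmetric matrix *)

Lemma char_poly_similar (K : fieldType) n (P A B : 'M[K]_n) :
  P \in unitmx -> P *m A = B *m P -> char_poly A = char_poly B.
Proof.
move=> Pu PA.
have dP : \det (map_mx polyC P) != 0.
  by rewrite det_map_mx polyC_eq0 -unitfE -unitmxE.
apply: (mulfI dP); rewrite -det_mulmx mulrC -det_mulmx; congr (\det _).
by rewrite /char_poly_mx mulmxBl mulmxBr -!map_mxM PA scalar_mxC.
Qed.

(** The spectral theorem for the hermitian matrix obtained by extending scalars
    to [R[i]] yields real eigenvalues, hence a factorization that descends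
    to [R]. *)
Lemma char_poly_realsym_split (R : realType) n (M : 'M[R]_n) :
  M^T = M -> exists s : seq R, char_poly M = \prod_(x <- s) ('X - x%:P).
Proof.
move=> Msym; pose C : numClosedFieldType := R[i].
pose f := real_complex R; pose Mc : 'M[C]_n := map_mx f M.
have Mreal : Mc \is a mxOver Num.real.
  by apply/mxOverP => i j; rewrite mxE; apply/complex_realP; exists (M i j).
have Mherm : Mc \is hermsymmx.
  apply: realsym_hermsym => //; apply/is_hermitianmxP.
  by apply/matrixP => i j; rewrite expr0 scale1r !mxE -[in LHS]Msym mxE.
have /orthomx_spectralP Mdiag := hermitian_normalmx Mherm.
have dreal := hermitian_spectral_diag_real Mherm.
set D := spectral_diag Mc in Mdiag dreal; set P := spectralmx Mc in Mdiag.
have cM : char_poly Mc = \prod_(i < n) ('X - (D 0 i)%:P).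
  rewrite (@char_poly_similar _ _ P Mc (diag_mx D)); first last.
  - by rewrite {1}Mdiag !mulmxA mulmxV ?spectral_unit// mul1mx.
  - exact: spectral_unit.
  rewrite char_poly_trig; last first.
    by apply: is_diag_mx_is_trig; exact: diag_mx_is_diag.
  by apply: eq_bigr => i _; rewrite mxE eqxx mulr1n.
exists [seq complex.Re (D 0 i) | i <- index_enum 'I_n].
apply: (map_poly_inj f); rewrite map_char_poly -/Mc cM rmorph_prod /= big_map.
apply: eq_bigr => i _; rewrite map_polyXsubC; congr ('X - _%:P).
exact/esym/RRe_real/(mxOverP dreal).
Qed.

Lemma spectrum_spec (R : realType) n (M : 'M[R]_n) : M^T = M ->
  sorted <=%R (spectrum M) /\
  char_poly M = \prod_(x <- spectrum M) ('X - x%:P).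
Proof.
move=> /char_poly_realsym_split[s Ms].
rewrite /spectrum; case: xgetP => [_ _ //|] /(_ (sort <=%R s)); case.
split; first exact: (sort_sorted le_total).
by rewrite Ms; apply: perm_big; rewrite perm_sym perm_sort.
Qed.

Lemma size_spectrum (R : realType) n (M : 'M[R]_n) : M^T = M ->
  size (spectrum M) = n.
Proof.
move=> /spectrum_spec[_ Ms]; have := size_char_poly M.
by rewrite Ms size_prod_XsubC => -[].
Qed.

Lemma char_poly_spectrum (R : realType) n (M : 'M[R]_n) : M^T = M ->
  char_poly M = \prod_(i < n) ('X - ((spectrum M)`_i)%:P).
Proof.
move=> Msym; have [_ ->] := spectrum_spec Msym.
by rewrite (big_nth 0) big_mkord size_spectrum.
Qed.

Lemma spectrum_le (R : realType) n (M : 'M[R]_n) i j : M^T = M ->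
  (i <= j < n)%N -> (spectrum M)`_i <= (spectrum M)`_j.
Proof.
move=> Msym /andP[ij jn]; have [ss _] := spectrum_spec Msym.
by apply: (sorted_leq_nth le_trans le_refl) => //;
  rewrite inE size_spectrum// (leq_ltn_trans ij).
Qed.

Lemma spectrum_uniq (R : realType) n (M : 'M[R]_n) (s : seq R) :
  sorted <=%R s -> char_poly M = \prod_(x <- s) ('X - x%:P) -> spectrum M = s.
Proof.
move=> ss Ms; rewrite /spectrum; case: xgetP => [t _ [st Mt]|/(_ s)[]//].
apply: (sorted_eq le_trans le_anti) => //.
by apply: prod_XsubC_eq; rewrite -Mt Ms.
Qed.

(** Compare both sides of [v *m M = a *: v] at an entry of [v] of largest
    modulus. *)
Lemma eigenvalue_norm_bound (R : realType) n (M : 'M[R]_n) a :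
  eigenvalue M a -> `|a| <= \sum_i \sum_j `|M i j|.
Proof.
move=> /eigenvalueP[v vM v0].
have /rV0Pn[i vi0] := v0.
pose k := [arg max_(j > i) `|v 0 j|]%O.
have vk j : `|v 0 j| <= `|v 0 k|.
  by rewrite /k; case: arg_maxP => // l _; apply.
have vk0 : 0 < `|v 0 k| by rewrite (lt_le_trans _ (vk i))// normr_gt0.
have /rowP/(_ k) := vM; rewrite !mxE => /(congr1 Num.norm).
rewrite normrM => avk; rewrite -(ler_pM2r vk0) -avk mulr_suml.
apply: le_trans (ler_norm_sum _ _ _) _; apply: ler_sum => j _.
rewrite normrM mulrC ler_pM// (bigD1 k)//= lerDl.
by apply: sumr_ge0.
Qed.

Lemma spectrum_norm_bound (R : realType) n (M : 'M[R]_n) i : M^T = M ->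
  `|(spectrum M)`_i| <= \sum_i \sum_j `|M i j|.
Proof.
move=> Msym; have [iM|Mi] := ltnP i (size (spectrum M)); last first.
  by rewrite nth_default// normr0 sumr_ge0// => ? _; exact: sumr_ge0.
apply: eigenvalue_norm_bound; rewrite eigenvalue_root_char.
have [_ ->] := spectrum_spec Msym.
by rewrite root_prod_XsubC mem_nth.
Qed.

(** * Kernel at a simple zero eigenvalue *)

(** Every entry of the adjugate is, up to sign, a minor of size [n.-1]. *)
Lemma adj_eq0 (K : fieldType) n (M : 'M[K]_n) :
  (\rank M < n.-1)%N -> \adj M = 0.
Proof.
move=> rM; apply/matrixP => i j; rewrite !mxE /cofactor.
have [->|] := eqVneq (\det (row' j (col' i M))) 0; first by rewrite mulr0.
rewrite -unitfE -unitmxE => /mxrank_unit rk; exfalso.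
move: rM; rewrite -rk ltnNge => /negP; apply.
rewrite row'Esub; apply: leq_trans (mxrankS (rowsub_sub _ _)) _.
rewrite -mxrank_tr tr_col' -[leqRHS]mxrank_tr row'Esub.
exact: mxrankS (rowsub_sub _ _).
Qed.

(** If the rank were smaller, [\adj M] would vanish. Write the characteristic
    polynomial as [q * 'X] and let [B] be the characteristic matrix, so that
    [u *m B = 'X *: u]. Multiplying by [\adj B] and cancelling ['X] gives
    [q *: u = u *m \adj B]; at [0] the right-hand side is [u *m \adj (- M)],
    which is zero, so [q.[0] = 0] and [0] is a multiple root. *)
Lemma simple_eigenvalue0_rank (K : fieldType) n (M : 'M[K]_n) (u : 'rV[K]_n) :
  u != 0 -> u *m M = 0 -> simple_eigenvalue M 0 -> (n.-1 <= \rank M)%N.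
Proof.
move=> u0 uM; rewrite /simple_eigenvalue leqNgt => s0; apply/negP => rM.
have p0 := monic_neq0 (char_poly_monic M).
have : ('X - (0 : K)%:P) ^+ 1 %| char_poly M by rewrite -mup_geq// s0.
rewrite subr0 => /dvdpP[q pq].
pose B := char_poly_mx M; pose U := map_mx polyC u.
have UB : U *m B = 'X *: U.
  rewrite /B /char_poly_mx mulmxBr -map_mxM uM map_mx0 subr0.
  by rewrite -scalemx1 -scalemxAr mulmx1.
have qU : q *: U = U *m \adj B.
  have /matrixP UBE : 'X *: (q *: U) = 'X *: (U *m \adj B).
    by rewrite scalemxAl -UB -mulmxA mul_mx_adj -/(char_poly M) pq scalerA
      mul_mx_scalar mulrC.
  apply/matrixP => i j; have := UBE i j; rewrite mxE [RHS]mxE.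
  by apply: mulfI; rewrite polyX_eq0.
have q0 : q.[0] = 0.
  have /rV0Pn[i ui] := u0.
  have adjB : map_mx (horner_eval 0) (\adj B) = 0.
    rewrite map_mx_adj /B /char_poly_mx map_mxB -map_mx_comp map_scalar_mx.
    rewrite /= horner_evalE hornerX raddf0 sub0r.
    rewrite (_ : map_mx _ M = M); last first.
      by apply/matrixP => k l; rewrite !mxE /= horner_evalE hornerC.
    by apply: adj_eq0; rewrite mxrank_opp.
  have := congr1 (map_mx (horner_eval 0)) qU.
  rewrite map_mxM adjB mulmx0 map_mxZ => /rowP/(_ i); rewrite !mxE.
  rewrite /= !horner_evalE hornerC => /eqP.
  by rewrite mulf_eq0 (negPf ui) orbF => /eqP.
have /factor_theorem[r qr] : root q 0 by apply/eqP.
have : (2 <= mup 0 (char_poly M))%N.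
  by rewrite mup_geq// pq qr subr0 expr1 -mulrA -expr2 dvdp_mulIr.
by rewrite s0.
Qed.

(** Algebraic multiplicity one forces geometric multiplicity one. *)
Lemma simple_eigenvalue0_kernel (K : fieldType) n (M : 'M[K]_n)
    (u v : 'rV[K]_n) :
  simple_eigenvalue M 0 -> u != 0 -> u *m M = 0 -> v *m M = 0 ->
  exists c, v = c *: u.
Proof.
move=> s0 u0 uM vM; have rM := simple_eigenvalue0_rank u0 uM s0.
apply/sub_rVP; rewrite (@submx_trans _ _ _ _ _ _ (kermx M))//.
  by apply/sub_kermxP.
have uk : (u <= kermx M)%MS by apply/sub_kermxP.
rewrite -(geq_leqif (mxrank_leqif_sup uk)) mxrank_ker rank_rV u0.
by rewrite leq_subLR addn1 (leq_trans (leqSpred n))// ltnS.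
Qed.

(** * Laplacian and left zero-eigenvector *)

Section laplacian.
Context {R : realType} {n : nat}.
Implicit Types (A : 'M[R]_n) (xi : 'rV[R]_n).

(** The all-ones matrix fills the kernel of the Laplacian when [0] is a simple
    eigenvalue with a left eigenvector whose entries have a nonzero sum; the
    inverse then yields the normalized left zero-eigenvector. *)
Definition bordered_laplacian A : 'M[R]_n := laplacian A + const_mx 1.

Lemma laplacian_ones A : laplacian A *m (const_mx 1 : 'cV_n) = 0.
Proof.
apply/matrixP => i j; rewrite mulmxBl mul_diag_mx !mxE mulr1; apply/eqP.
by rewrite subr_eq0; apply/eqP/eq_bigr => k _; rewrite mxE mulr1.
Qed.

Lemma mulmx_onesE m (u : 'M[R]_(m, n)) p i (j : 'I_p) :
  (u *m const_mx 1) i j = \sum_k u i k.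
Proof. by rewrite mxE; apply: eq_bigr => k _; rewrite mxE mulr1. Qed.

Lemma sum_bordered_laplacian A (u : 'rV[R]_n) :
  \sum_j (u *m bordered_laplacian A) 0 j = n%:R * \sum_i u 0 i.
Proof.
have <- := mulmx_onesE (u *m bordered_laplacian A) 0 (0 : 'I_1).
rewrite mulmxDr mulmxDl -mulmxA laplacian_ones mulmx0 add0r mulmx_onesE.
rewrite (eq_bigr (fun=> \sum_i u 0 i)) => [|k _]; last exact: mulmx_onesE.
by rewrite sumr_const card_ord mulr_natl.
Qed.

(** The equations [xi *m L = 0] and [\sum_i xi 0 i = 1] amount to the single
    linear system [xi *m (L + J) = const_mx 1], where [J] is the all-ones matrix:
    summing the entries of both sides recovers the normalization because
    [L] annihilates the all-ones column. So the left zero-eigenvector is a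
    rational function of the weights. *)
Lemma left_zero_vecP A xi : (0 < n)%N -> bordered_laplacian A \in unitmx ->
  is_left_zero_vec (laplacian A) xi <->
  xi = const_mx 1 *m invmx (bordered_laplacian A).
Proof.
move=> n0 Nu.
suff -> : is_left_zero_vec (laplacian A) xi <->
    xi *m bordered_laplacian A = const_mx 1.
  by split=> [<-|->]; rewrite ?mulmxK ?mulmxKV.
split=> [[xiL xi1]|xiN].
  by rewrite mulmxDr xiL add0r; apply/rowP => j; rewrite mulmx_onesE mxE.
have xi1 : \sum_i xi 0 i = 1.
  have n0R : n%:R != 0 :> R by rewrite pnatr_eq0 -lt0n.
  apply: (mulIf n0R); rewrite mul1r.
  rewrite mulrC -(sum_bordered_laplacian A) xiN.
  by rewrite (eq_bigr (fun=> 1)) => [|k _]; rewrite ?mxE// sumr_const card_ord.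
split=> //; move: xiN; rewrite mulmxDr.
have -> : xi *m (const_mx 1 : 'M[R]_n) = const_mx 1.
  by apply/rowP => j; rewrite mulmx_onesE mxE.
by rewrite -[RHS]add0r => /addIr.
Qed.

(** A left kernel vector [v] of the bordered Laplacian has entries summing to
    [0], so it is a left kernel vector of the Laplacian, hence a multiple of [xi];
    as the entries of [xi] sum to [1], [v = 0]. *)
Lemma bordered_laplacian_unit A :
  simple_eigenvalue (laplacian A) 0 ->
  (exists xi, is_left_zero_vec (laplacian A) xi) ->
  bordered_laplacian A \in unitmx.
Proof.
move=> s0 [xi [xiL xi1]]; rewrite -row_free_unit -kermx_eq0.
apply/rowV0P => v /sub_kermxP vN.
have xi0 : xi != 0.
  apply/eqP => xi0; move: xi1; rewrite xi0 big1 => [/eqP|i _]; last first.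
    by rewrite mxE.
  by rewrite eq_sym oner_eq0.
have n0 : n%:R != 0 :> R.
  rewrite pnatr_eq0 -lt0n; have /rV0Pn[i _] := xi0.
  by rewrite (leq_ltn_trans _ (ltn_ord i)).
have v1 : \sum_i v 0 i = 0.
  apply: (mulIf n0); rewrite mul0r.
  rewrite mulrC -(sum_bordered_laplacian A) vN.
  by apply: big1 => k _; rewrite mxE.
have vL : v *m laplacian A = 0.
  move: vN; rewrite mulmxDr => <-; rewrite -[LHS]addr0; congr (_ + _).
  by apply/rowP => j; rewrite mulmx_onesE v1 mxE.
have [c vE] := simple_eigenvalue0_kernel s0 xi0 xiL vL.
move: v1; rewrite vE; under eq_bigr do rewrite mxE.
by rewrite -mulr_sumr xi1 mulr1 => ->; rewrite scale0r.
Qed.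

Lemma left_zero_vecE A : (0 < n)%N -> bordered_laplacian A \in unitmx ->
  left_zero_vec (laplacian A) = const_mx 1 *m invmx (bordered_laplacian A).
Proof.
move=> n0 Nu; rewrite /left_zero_vec; case: xgetP => [xi _ xiP|].
  exact/left_zero_vecP.
move=> /(_ (const_mx 1 *m invmx (bordered_laplacian A)))[].
exact/left_zero_vecP.
Qed.

Lemma connectivity_definedP A : (0 < n)%N -> bordered_laplacian A \in unitmx ->
  (forall i, 0 < left_zero_vec (laplacian A) 0 i) -> connectivity_defined A.
Proof.
move=> n0 Nu xi_gt0.
have xiP : is_left_zero_vec (laplacian A) (left_zero_vec (laplacian A)).
  by apply/left_zero_vecP => //; exact: left_zero_vecE.
split; exists (left_zero_vec (laplacian A)) => //.
split=> // xi /left_zero_vecP xiE.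
by rewrite left_zero_vecE// xiE.
Qed.

Lemma gen_matrixE A i j :
  let L := laplacian A in let xi := left_zero_vec L in
  gen_matrix A i j = 2^-1 * ((Num.sqrt (xi 0 i))^-1 *
    (xi 0 i * L i j + L j i * xi 0 j) * (Num.sqrt (xi 0 j))^-1).
Proof.
move=> L xi; rewrite /gen_matrix /symmetrized_laplacian -/L -/xi.
rewrite mul_mx_diag mxE -scalemxAr mul_diag_mx mul_diag_mx mul_mx_diag !mxE.
ring.
Qed.

Lemma gen_matrix_sym A : (gen_matrix A)^T = gen_matrix A.
Proof.
apply/matrixP => i j; rewrite mxE !gen_matrixE.
ring.
Qed.

End laplacian.

(** * Differentiable functions on a normed module *)

Local Open Scope classical_set_scope.
Local Open Scope ring_scope.

Section differentiable.
Context {R : realType} {V : normedModType R}.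
Implicit Types (f g : V -> R) (x : V).

(** The function is constant to first order, so its differential is [0]. *)
Lemma differentiable_littleo f x :
  (forall e, 0 < e -> \forall h \near (0 : V), `|f (h + x) - f x| <= e * `|h|) ->
  differentiable f x.
Proof.
move=> fo; have fE : f \o shift x = cst (f x) + \0 +o_ 0 id.
  apply/eqaddoP => e e0; near=> h.
  have -> : (f \o shift x - (cst (f x) + \0)) h = f (h + x) - f x.
    by rewrite /= !fctE /= addr0.
  by near: h; exact: fo.
have df0 : 'd f x = \0 :> (V -> R) by apply: diff_unique => // y; exact: cvg_cst.
by apply/diff_locallyP; rewrite df0; split => // y; exact: cvg_cst.
Unshelve. all: by end_near. Qed.

(** The difference [g - f] vanishes near [x]. *)
Lemma near_differentiable f g x :
  {near x, f =1 g} -> differentiable f x -> differentiable g x.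
Proof.
move=> fg df; rewrite (_ : g = f + (g - f)); last by rewrite addrC subrK.
apply: differentiableD => //; apply: differentiable_littleo => e e0.
have fgx : f x = g x by exact: nbhs_singleton fg.
have : \forall h \near (0 : V), f (h + x) = g (h + x).
  by rewrite (near_shift x) sub0r; near=> z; rewrite /= subrK; near: z.
apply: filterS => h fgh; rewrite !fctE fgh fgx !subrr normr0.
by rewrite mulr_ge0// ltW.
Unshelve. all: by end_near. Qed.

Lemma differentiable_lipschitz f x : differentiable f x ->
  exists2 C, 0 < C & \forall h \near (0 : V), `|f (h + x) - f x| <= C * `|h|.
Proof.
move=> df; have [k k0 dfk] := linear_lipschitz (diff_continuous df).
exists (k + 1); first by rewrite addr_gt0.
have /eqaddoP/(_ 1 ltr01) := diff_locally df.
apply: filterS => h; rewrite !fctE /= mul1r => fh.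
have -> : f (h + x) - f x = 'd f x h + (f (h + x) - (f x + 'd f x h)) by ring.
by rewrite (le_trans (ler_normD _ _))// mulrDl mul1r lerD.
Qed.

(** Where [f] vanishes, continuity of [g] suffices for the product rule: write
    [f * g = g x *: f + f * (g - cst (g x))]; the second term is the product of
    an [O(h)] and an [o(1)]. *)
Lemma differentiableM0 f g x : f x = 0 -> differentiable f x ->
  {for x, continuous g} -> differentiable (f * g) x.
Proof.
move=> fx0 df gx.
have -> : f * g = g x *: f + f * (g - cst (g x)).
  by apply/funext => y; rewrite !fctE mulrBr [g x *: _]mulrC addrC subrK.
apply: differentiableD; first exact: differentiableZ.
apply: differentiable_littleo => e e0.
have [C C0 fC] := differentiable_lipschitz df.
have gh : \forall h \near (0 : V), `|g (h + x) - g x| <= e / C.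
  suff : \forall y \near x, `|g y - g x| <= e / C.
    move=> gy; rewrite (near_shift x) sub0r.
    by near=> z; rewrite /= subrK; near: z.
  by move/cvgrPdistC_le : gx; apply; rewrite divr_gt0.
near=> h; rewrite !fctE fx0 mul0r subr0 normrM.
have -> : e * `|h| = (C * `|h|) * (e / C).
  by field; rewrite gt_eqF.
apply: ler_pM => //; last by near: h.
by rewrite -[f _]subr0 -fx0; near: h.
Unshelve. all: by end_near. Qed.

Lemma differentiable_bigsum (I : Type) (r : seq I) (P : pred I)
    (F : I -> V -> R) x :
  (forall i, P i -> differentiable (F i) x) ->
  differentiable (fun y => \sum_(i <- r | P i) F i y) x.
Proof.
move=> dF; elim: r => [|i r IH].
  rewrite (_ : (fun y => _) = cst 0); last by apply/funext => y; rewrite big_nil.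
  exact: differentiable_cst.
have [Pi|Pi] := boolP (P i); last first.
  rewrite (_ : (fun y => \sum_(j <- i :: r | P j) F j y) =
      fun y => \sum_(i <- r | P i) F i y) //.
  by apply/funext => y; rewrite big_cons (negPf Pi).
rewrite (_ : (fun y => \sum_(j <- i :: r | P j) F j y) =
    F i + fun y => \sum_(i <- r | P i) F i y).
  by apply: differentiableD => //; exact: dF.
by apply/funext => y; rewrite big_cons Pi.
Qed.

Lemma differentiable_bigprod (I : Type) (r : seq I) (P : pred I)
    (F : I -> V -> R) x :
  (forall i, P i -> differentiable (F i) x) ->
  differentiable (fun y => \prod_(i <- r | P i) F i y) x.
Proof.
move=> dF; elim: r => [|i r IH].
  rewrite (_ : (fun y => _) = cst 1); last by apply/funext => y; rewrite big_nil.
  exact: differentiable_cst.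
have [Pi|Pi] := boolP (P i); last first.
  rewrite (_ : (fun y => \prod_(j <- i :: r | P j) F j y) =
      fun y => \prod_(i <- r | P i) F i y) //.
  by apply/funext => y; rewrite big_cons (negPf Pi).
rewrite (_ : (fun y => \prod_(j <- i :: r | P j) F j y) =
    F i * fun y => \prod_(i <- r | P i) F i y).
  by apply: differentiableM => //; exact: dF.
by apply/funext => y; rewrite big_cons Pi.
Qed.

Lemma differentiable_det n (M : V -> 'M[R]_n) x :
  (forall i j, differentiable (fun y => M y i j) x) ->
  differentiable (fun y => \det (M y)) x.
Proof.
move=> dM; rewrite /determinant.
apply: differentiable_bigsum => s _; apply: differentiableM.
  exact: differentiable_cst.
exact: differentiable_bigprod.
Qed.

(** Cramer's rule near [x]. *)
Lemma differentiable_invmx n (M : V -> 'M[R]_n) x i j :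
  M x \in unitmx ->
  (forall i j, differentiable (fun y => M y i j) x) ->
  differentiable (fun y => invmx (M y) i j) x.
Proof.
move=> Mu dM.
have ddet : differentiable (fun y => \det (M y)) x by exact: differentiable_det.
have det0 : \det (M x) != 0 by rewrite -unitfE -unitmxE.
have Mnear : \forall y \near x, M y \in unitmx.
  have : \forall y \near x, \det (M y) != 0.
    exact: (cvgr_neq0 _ (differentiable_continuous ddet) det0).
  by apply: filterS => y; rewrite unitmxE unitfE.
apply: (@near_differentiable (fun y => (\det (M y))^-1 * \adj (M y) i j)).
  by apply: filterS Mnear => y My; rewrite /invmx My [RHS]mxE.
apply: differentiableM; first exact: differentiableV.
rewrite (_ : (fun y => _) =
    fun y => (-1) ^+ (j + i) * \det (row' j (col' i (M y)))); last first.
  by apply/funext => y; rewrite mxE.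
apply: differentiableM; first exact: differentiable_cst.
apply: differentiable_det => k l.
rewrite (_ : (fun y => _) = fun y => M y (lift j k) (lift i l)) //.
by apply/funext => y; rewrite !mxE.
Qed.

Lemma differentiable_sqrt f x : 0 < f x -> differentiable f x ->
  differentiable (fun y => Num.sqrt (f y)) x.
Proof.
move=> fx df; apply: (differentiable_comp df).
by apply/derivable1_diffP; have [] := is_derive1_sqrt fx.
Qed.

Lemma is_derive_line f x v : differentiable f x ->
  is_derive (0 : R) 1 (fun e => f (x + e *: v)) ('d f x v).
Proof.
move=> df.
have quotE : (fun h : R => h^-1 *: (((fun e => f (x + e *: v)) \o shift 0)
      (h *: 1) - f (x + 0 *: v))) =
    (fun h => h^-1 *: ((f \o shift x) (h *: v) - f x)).
  by apply/funext => h; rewrite /= addr0 scale0r addr0 [_%:A]mulr1 (addrC x).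
by split; rewrite ?/derivable ?/derive quotE -?deriveE//; exact: diff_derivable.
Qed.

End differentiable.

(** * Continuity of the ordered spectrum *)

Lemma cvg_mx (R : realType) m n (T : Type) (F : set_system T) {FF : Filter F}
    (M : T -> 'M[R]_(m, n)) (M0 : 'M[R]_(m, n)) :
  (forall i j, M t i j @[t --> F] --> M0 i j) -> M t @[t --> F] --> M0.
Proof.
move=> MF A [P M0P PA]; apply: (@filterS _ F _ _ _ (fun t => PA (M t))).
apply: filter_forall => i; apply: filter_forall => j.
exact: MF.
Qed.

Lemma poly_eq_horner (R : numDomainType) (p q : {poly R}) :
  (forall a, p.[a] = q.[a]) -> p = q.
Proof.
move=> pq; apply/eqP; rewrite -subr_eq0; apply/negPn/negP => r0.
pose rs : seq R := [seq i%:R | i <- iota 0 (size (p - q))].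
have rs_uniq : uniq rs.
  by rewrite map_inj_uniq ?iota_uniq//; exact: (mulrIn (oner_neq0 _)).
have := max_poly_roots r0 _ rs_uniq.
rewrite size_map size_iota ltnn => /(_ _)/negP; apply=> //.
by apply/allP => a _; rewrite /root !hornerE pq subrr.
Qed.

Lemma horner_char_poly (K : comNzRingType) n (M : 'M[K]_n) a :
  (char_poly M).[a] = \det (a%:M - M).
Proof.
rewrite /char_poly -horner_evalE -det_map_mx; congr (\det _).
by apply/matrixP => i j; rewrite !mxE /= horner_evalE !hornerE hornerMn hornerX.
Qed.

Lemma spectrum_row (R : realType) n (M : 'M[R]_n) (y : 'rV[R]_n) :
  (forall i j : 'I_n, (i <= j)%N -> y 0 i <= y 0 j) ->
  char_poly M = \prod_i ('X - (y 0 i)%:P) ->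
  y = \row_i (spectrum M)`_i.
Proof.
move=> ysorted My.
rewrite (@spectrum_uniq _ _ _ [tuple y 0 i | i < n]).
- by apply/rowP => i; rewrite mxE nth_mktuple.
- apply/(sortedP 0) => k; rewrite size_tuple => kn.
  rewrite -[k]/(val (Ordinal (ltnW kn))) -[k.+1]/(val (Ordinal kn)).
  by rewrite !nth_mktuple ysorted/=.
- by rewrite My big_map big_enum.
Qed.

(** Continuity of the ordered spectrum by compactness. The eigenvalues stay in a
    compact box, so it suffices that the limit spectrum is the only cluster point
    of the moving one. A cluster point is ordered, and the polynomial having its
    entries as roots is the limit of the characteristic polynomials; by uniqueness
    of the factorization it is the spectrum of the limit. *)
Lemma cvg_spectrum (R : realType) n (T : Type) (F : set_system T)
    {FF : ProperFilter F} (M : T -> 'M[R]_n) (M0 : 'M[R]_n) :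
  (forall t, (M t)^T = M t) -> M t @[t --> F] --> M0 ->
  \row_i (spectrum (M t))`_i @[t --> F] --> (\row_i (spectrum M0)`_i : 'rV[R]_n).
Proof.
move=> Msym MF.
have coordF i j : M t i j @[t --> F] --> M0 i j.
  exact: (cvg_comp _ _ MF (@coord_continuous _ _ _ i j M0)).
have M0sym : M0^T = M0.
  apply/matrixP => i j; rewrite mxE.
  have MT : M t j i @[t --> F] --> M0 i j.
    rewrite (_ : (fun t => M t j i) = fun t => M t i j) //.
    by apply/funext => t; rewrite -[in LHS]Msym mxE.
  exact: (norm_cvg_unique (coordF j i) MT).
pose s (N : 'M[R]_n) : 'rV[R]_n := \row_i (spectrum N)`_i.
rewrite -/(s M0) -/(s (M _)).
pose bnd (N : 'M[R]_n) := \sum_i \sum_j `|N i j|.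
pose V := [set v : 'rV[R]_n | forall i, v 0 i \in `[- (bnd M0 + 1), bnd M0 + 1]].
have Vcompact : compact V.
  apply: (@rV_compact _ _ (fun=> [set` `[- (bnd M0 + 1), bnd M0 + 1]])) => i.
  exact: segment_compact.
have bndF : bnd (M t) @[t --> F] --> bnd M0.
  apply: cvg_big => [|i _]; first exact: add_continuous.
  apply: cvg_big => [|j _]; first exact: add_continuous.
  exact: cvg_norm.
have FV : \forall t \near F, V (s (M t)).
  have : \forall t \near F, bnd (M t) <= bnd M0 + 1.
    by apply: (cvgr_le _ bndF); rewrite ltrDl.
  apply: filterS => t Mt i; rewrite mxE in_itv /= -ler_norml.
  exact: le_trans (spectrum_norm_bound i (Msym t)) Mt.
(* The bound [bnd M0 + 1] leaves room for a neighbourhood of [s M0] in [V]. *)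
have nV : nbhs (s M0) V.
  have nVi i : nbhs (s M0) [set v : 'rV[R]_n |
      v 0 i \in `[- (bnd M0 + 1), bnd M0 + 1]].
    have si : `|s M0 0 i| < bnd M0 + 1.
      by rewrite mxE (le_lt_trans (spectrum_norm_bound i M0sym))// ltrDl.
    have : nbhs (s M0) [set v : 'rV[R]_n | `|v 0 i| < bnd M0 + 1].
      exact: (cvgr_lt _ (cvg_norm (@coord_continuous _ _ _ 0 i (s M0)))).
    by apply: filterS => v /= /ltW vi; rewrite in_itv /= -ler_norml.
  apply: filterS (@filter_forall _ _ _ (nbhs (s M0)) _ nVi) => v; exact.
have cluster_s y : cluster (s (M t) @[t --> F]) y -> y = s M0.
  rewrite cluster_cvgE => -[G PG [Gy FG]].
  have Gcoord i : v 0 i @[v --> G] --> y 0 i.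
    exact: (cvg_comp _ _ Gy (@coord_continuous _ _ _ 0 i y)).
  apply: spectrum_row => [i j ij|].
    apply: (ler_cvg_to (Gcoord i) (Gcoord j)).
    have Fs : \forall t \near F, s (M t) 0 i <= s (M t) 0 j.
      by apply: filterE => t; rewrite !mxE spectrum_le// ij/=.
    exact: FG Fs.
  apply: poly_eq_horner => a.
  rewrite horner_prod.
  pose h (v : 'rV[R]_n) := \prod_i (a - v 0 i).
  have Gh : h v @[v --> G] --> h y.
    apply: cvg_big => [|i _]; first exact: mul_continuous.
    by apply: (cvgB (cvg_cst a) (Gcoord i)).
  have hs t : h (s (M t)) = \det (a%:M - M t).
    rewrite -horner_char_poly char_poly_spectrum// horner_prod.
    by apply: eq_bigr => i _; rewrite mxE !hornerE.
  rewrite horner_char_poly.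
  have Fh : h (s (M t)) @[t --> F] --> \det (a%:M - M0).
    rewrite (_ : (fun t => h _) = fun t => \det (a%:M - M t)); last exact/funext.
    have det_cts : {for M0, continuous (fun N : 'M[R]_n => \det (a%:M - N))}.
      apply: differentiable_continuous; apply: differentiable_det => i j.
      rewrite (_ : (fun N : 'M[R]_n => _) =
          cst (a *+ (i == j)) - fun N : 'M[R]_n => N i j).
        apply: differentiableB; [exact: differentiable_cst|].
        exact: differentiable_coord.
      by apply/funext => N; rewrite !mxE.
    exact: (cvg_comp _ _ MF det_cts).
  (* [G] refines the image of [F], hence inherits its limits. *)
  have Gh' : h v @[v --> G] --> \det (a%:M - M0).
    by move=> A /Fh FA; exact: FG.
  have -> : \prod_i ('X - (y 0 i)%:P).[a] = h y.
    by apply: eq_bigr => i _; rewrite !hornerE.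
  exact: (norm_cvg_unique Gh' Gh).
apply: (@compact_cluster_set1 _ (s M0) _ V) => //.
apply/seteqP; split=> [y /cluster_s//|_ ->].
have [y [_ yc]] := Vcompact (s (M t) @[t --> F]) _ FV.
by rewrite -(cluster_s y yc).
Qed.

(** * Differentiability of the connectivity *)

Section connectivity.
Context {R : realType} {n : nat}.
Implicit Types A B : 'M[R]_n.

Lemma differentiable_laplacian A i j :
  differentiable (fun B => laplacian B i j) A.
Proof.
rewrite (_ : (fun B => _) =
    (fun B => \sum_k B i k *+ (i == j)) - fun B : 'M[R]_n => B i j); last first.
  by apply/funext => B; rewrite !mxE fctE -sumrMnl.
apply: differentiableB; last exact: differentiable_coord.
apply: differentiable_bigsum => k _.
by case: (i == j); [exact: differentiable_coord|exact: differentiable_cst].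
Qed.

Lemma differentiable_bordered_laplacian A i j :
  differentiable (fun B => bordered_laplacian B i j) A.
Proof.
rewrite (_ : (fun B => _) = (fun B => laplacian B i j) + cst 1); last first.
  by apply/funext => B; rewrite fctE /bordered_laplacian mxE [const_mx _ _ _]mxE.
apply: differentiableD; last exact: differentiable_cst.
exact: differentiable_laplacian.
Qed.

Lemma near_bordered_laplacian_unit A : bordered_laplacian A \in unitmx ->
  \forall B \near A, bordered_laplacian B \in unitmx.
Proof.
rewrite unitmxE unitfE => dA.
have : differentiable (fun B => \det (bordered_laplacian B)) A.
  by apply: differentiable_det => i j; exact: differentiable_bordered_laplacian.
move=> /differentiable_continuous dc.
have : \forall B \near A, \det (bordered_laplacian B) != 0.
  exact: (cvgr_neq0 _ dc dA).
by apply: filterS => B; rewrite unitmxE unitfE.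
Qed.

Lemma differentiable_left_zero_vec A i :
  (0 < n)%N -> bordered_laplacian A \in unitmx ->
  differentiable (fun B => left_zero_vec (laplacian B) 0 i) A.
Proof.
move=> n_gt0 Nu.
apply: (@near_differentiable _ _
    (fun B => \sum_k 1 * invmx (bordered_laplacian B) k i)).
  apply: filterS (near_bordered_laplacian_unit Nu) => B NB.
  rewrite left_zero_vecE// [RHS]mxE.
  by apply: eq_bigr => k _; rewrite [const_mx _ _ _]mxE.
apply: differentiable_bigsum => k _; apply: differentiableM.
  exact: differentiable_cst.
by apply: differentiable_invmx => // *; exact: differentiable_bordered_laplacian.
Qed.

Lemma near_connectivity_defined A : (0 < n)%N ->
  bordered_laplacian A \in unitmx ->
  (forall i, 0 < left_zero_vec (laplacian A) 0 i) ->
  \forall B \near A, connectivity_defined B.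
Proof.
move=> n_gt0 Nu xi_gt0.
have xi_near i : \forall B \near A, 0 < left_zero_vec (laplacian B) 0 i.
  have := differentiable_continuous (differentiable_left_zero_vec i n_gt0 Nu).
  by move=> xi_cts; exact: (cvgr_gt _ xi_cts _ (xi_gt0 i)).
near=> B; apply: connectivity_definedP => //.
  by near: B; exact: near_bordered_laplacian_unit.
by near: B; exact: (@filter_forall _ _ _ (nbhs A) _ xi_near).
Unshelve. all: by end_near. Qed.

Lemma differentiable_gen_matrix A i j : (0 < n)%N ->
  bordered_laplacian A \in unitmx ->
  (forall i, 0 < left_zero_vec (laplacian A) 0 i) ->
  differentiable (fun B => gen_matrix B i j) A.
Proof.
move=> n_gt0 Nu xi_gt0.
pose L := fun i j (B : 'M[R]_n) => laplacian B i j.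
pose xi := fun i (B : 'M[R]_n) => left_zero_vec (laplacian B) 0 i.
have dL k l : differentiable (L k l) A by exact: differentiable_laplacian.
have dxi k : differentiable (xi k) A by exact: differentiable_left_zero_vec.
have dsqrt k : differentiable (fun B => (Num.sqrt (xi k B))^-1) A.
  apply: differentiableV; first exact: differentiable_sqrt (xi_gt0 k) (dxi k).
  by rewrite gt_eqF// sqrtr_gt0; exact: xi_gt0.
rewrite (_ : (fun B => _) = cst 2^-1 * ((fun B => (Num.sqrt (xi i B))^-1) *
    (xi i * L i j + L j i * xi j) * (fun B => (Num.sqrt (xi j B))^-1))).
  have dsum : differentiable (xi i * L i j + L j i * xi j) A.
    exact: differentiableD (differentiableM (dxi i) (dL i j))
      (differentiableM (dL j i) (dxi j)).
  have dprod := differentiableM (differentiableM (dsqrt i) dsum) (dsqrt j).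
  by apply: (differentiableM _ dprod); exact: differentiable_cst.
by apply/funext => B; rewrite gen_matrixE.
Qed.

(** Evaluating the factored characteristic polynomial of [gen_matrix B] at
    [kappa], the value of the connectivity at [A], and isolating the factor of
    the second eigenvalue gives
    [P B = (kappa - gen_alg_connectivity B) * Q B], where [Q B] is the product of
    [kappa - s] over the other eigenvalues [s]. Here [P] is differentiable and
    vanishes at [A], while [Q] is continuous at [A] by [cvg_spectrum] and nonzero
    there because [kappa] is simple. [differentiableM0] then applies to
    [kappa - gen_alg_connectivity = P * Q^-1]. *)
Lemma differentiable_gen_alg_connectivity A : (1 < n)%N ->
  bordered_laplacian A \in unitmx ->
  (forall i, 0 < left_zero_vec (laplacian A) 0 i) ->
  simple_eigenvalue (gen_matrix A) (gen_alg_connectivity A) ->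
  differentiable (@gen_alg_connectivity R n) A.
Proof.
move=> n_ge2 Nu xi_gt0 simple; have n_gt0 := ltnW n_ge2.
pose kappa := gen_alg_connectivity A.
pose s B i := (spectrum (gen_matrix B))`_i.
(* Indices start at 0: the second eigenvalue has index 1. *)
pose i1 : 'I_n := Ordinal n_ge2.
pose P B := \det (kappa%:M - gen_matrix B).
pose Q B := \prod_(i < n | i != i1) (kappa - s B i).
have charE B : P B = \prod_(i < n) (kappa - s B i).
  rewrite /P -horner_char_poly (char_poly_spectrum (gen_matrix_sym B)).
  by rewrite horner_prod; apply: eq_bigr => i _; rewrite !hornerE.
have s_cts (i : 'I_n) : {for A, continuous (fun B => s B i)}.
  have gA : gen_matrix B @[B --> A] --> gen_matrix A.
    apply: (@cvg_mx _ _ _ _ (nbhs A)) => i' j; apply: differentiable_continuous.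
    exact: differentiable_gen_matrix.
  have sA := cvg_spectrum (FF := nbhs_pfilter A) (@gen_matrix_sym R n) gA.
  rewrite (_ : (fun B => s B i) = (fun v : 'rV[R]_n => v 0 i) \o
      fun B => \row_j (spectrum (gen_matrix B))`_j); last first.
    by apply/funext => B; rewrite /= mxE.
  exact: (cvg_comp _ _ sA (@coord_continuous _ _ _ 0 i _)).
have Q_cts : {for A, continuous Q}.
  apply: (@cvg_big _ _ _ _ _ (@mul_continuous _) _ (nbhs A)) => i _.
  by apply: (cvgB (cvg_cst kappa) (s_cts i)).
have QA : Q A != 0.
  apply/prodf_neq0 => i ii1; rewrite subr_eq0; apply/eqP => si.
  suff : (2 <= mup kappa (char_poly (gen_matrix A)))%N by rewrite simple.
  rewrite mup_geq ?monic_neq0 ?char_poly_monic//.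
  rewrite (char_poly_spectrum (gen_matrix_sym A)) (bigD1 i1)//= (bigD1 i)//=.
  by rewrite -/(s A i) -si mulrA expr2 dvdp_mulr.
have PA : P A = 0.
  by rewrite charE (bigD1 i1)//= subrr mul0r.
have dP : differentiable P A.
  apply: differentiable_det => i j.
  rewrite (_ : (fun B => _) =
      cst (kappa *+ (i == j)) - fun B => gen_matrix B i j).
    apply: differentiableB; [exact: differentiable_cst|].
    exact: differentiable_gen_matrix.
  apply/funext => B; rewrite !fctE; move: (gen_matrix B) => N.
  by rewrite !mxE.
apply: (@near_differentiable _ _ (cst kappa - P * (fun B => (Q B)^-1))).
  have : \forall B \near A, Q B != 0 by exact: (cvgr_neq0 _ Q_cts QA).
  apply: filterS => B QB; rewrite !fctE charE (bigD1 i1)//= -/(Q B).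
  by rewrite mulfK// opprB addrC subrK.
apply: differentiableB; first exact: differentiable_cst.
apply: differentiableM0 => //.
exact: (cvgV QA Q_cts).
Qed.

End connectivity.

(** * Additivity of the sensitivity *)

Unset Implicit Arguments.

Theorem mainTheorem2 (R : realType) (n : nat) (n_ge2 : (2 <= n)%N)
    (A : 'M[R]_n) (no_loops : forall i, A i i = 0)
    (hA1 : assumption_A1 A) (hA2 : assumption_A2 A) (hA3 : assumption_A3 A)
    (F : {set 'I_n * 'I_n}) (hF : directed_edge_set F) :
  [/\ has_sensitivity A F,
      forall e, e \in F -> has_sensitivity A [set e]%SET
    & sensitivity A F = \sum_(e in F) sensitivity A [set e]%SET].
Proof.
have n_gt0 : (0 < n)%N by exact: ltnW.
have [A_simple _] := hA1; have [xi xiP xi_gt0] := hA2.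
have [_ _ kappa_simple] := hA3.
have Nu : bordered_laplacian A \in unitmx.
  by apply: bordered_laplacian_unit => //; exists xi.
have left_gt0 i : 0 < left_zero_vec (laplacian A) 0 i.
  suff -> : left_zero_vec (laplacian A) = xi by [].
  by rewrite left_zero_vecE//; apply/esym/left_zero_vecP.
have kappa_diff := differentiable_gen_alg_connectivity n_ge2 Nu left_gt0
  kappa_simple.
pose dir (G : {set 'I_n * 'I_n}) : 'M[R]_n := \sum_(e in G) delta_mx e.2 e.1.
have dline G : is_derive (0 : R) 1 (perturbed_connectivity A G)
    ('d (@gen_alg_connectivity R n) A (dir G)).
  (* By definition this is the connectivity along a line through [A]. *)
  exact: is_derive_line.
have sens G : has_sensitivity A G.
  split; last exact: ex_derive.
  have dir_cts : perturbed A G eps @[eps --> (0 : R)] --> A.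
    rewrite -[X in _ --> X]addr0 -(scale0r (dir G)).
    by apply: cvgD; [exact: cvg_cst|exact: cvgZr_tmp].
  exact: (dir_cts _ (near_connectivity_defined n_gt0 Nu left_gt0)).
have sensE G : sensitivity A G = 'd (@gen_alg_connectivity R n) A (dir G).
  by rewrite /sensitivity derive1E derive_val.
split=> //; rewrite sensE linear_sum; apply: eq_bigr => e _.
by rewrite sensE /dir big_set1.
Qed.
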